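(* Let $G=\{G_n\}_{n\in\mathbb{N}}$ be an ordered mean. Let $\mathbf{A}=(A_1,\dots,A_n)\in\mathbb{P}^n$ and $\omega=(w_1,\dots,w_n)\in\Delta_n$. Then for all $t\in[0,1]$: (i) $(1-t)G^\mu(\omega;\mathbf{A})+tG^\nu(\omega;\mathbf{A})\le G^{(1-t)\mu+t\nu}(\omega;\mathbf{A})$ for any $\mu,\nu\ge0$; and (ii) $(1-t)G^\mu(\omega;\mathbf{A})+tG^\nu(\omega;\mathbf{A})\ge G^{(1-t)\mu+t\nu}(\omega;\mathbf{A})$ for any $\mu,\nu<0$.
   Context: Let $\mathcal{H}$ be a Hilbert space and $\mathbb{P}$ the open convex cone of positive invertible bounded linear operators on $\mathcal{H}$; $I$ is the identity. For self-adjoint $A,B$, $A\le B$ means $B-A$ is positive semi-definite (Loewner order). $\Delta_n$ is the set of probability vectors $\omega=(w_1,\dots,w_n)\in\mathbb{R}^n$ with all $w_i>0$ and $\sum_i w_i=1$. An ordered mean is a family $G=\{G_n\}_{n\in\mathbb{N}}$ of maps $G_n:\Delta_n\times\mathbb{P}^n\to\mathbb{P}$ such that for every $n$, all $\mathbf{A},\mathbf{B}\in\mathbb{P}^n$, $\omega\in\Delta_n$ and real $a>0$: (P1) $G_n(\omega;a\mathbf{A})=aG_n(\omega;\mathbf{A})$; (P2) $G_n(\omega;\mathbf{B})\le G_n(\omega;\mathbf{A})$ whenever $B_i\le A_i$ for all $i$; (P3) $G_n(\omega;(1-s)\mathbf{A}+s\mathbf{B})\ge(1-s)G_n(\omega;\mathbf{A})+sG_n(\omega;\mathbf{B})$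 for $0\le s\le1$; (P4) $\left[\sum_{i=1}^n w_iA_i^{-1}\right]^{-1}\le G_n(\omega;\mathbf{A})\le\sum_{i=1}^n w_iA_i$. Parameterized ordered mean (subscript $n$ suppressed): for real $\mu\ge0$, $G^\mu(\omega;\mathbf{A}):=G_n(\omega;A_1+\mu I,\dots,A_n+\mu I)-\mu I$ (an element of $\mathbb{P}$); for real $\mu<0$, $G^\mu(\omega;\mathbf{A}):=G^{-\mu}(\omega;A_1^{-1},\dots,A_n^{-1})^{-1}$. *)

(* Defs.v *)
From HB Require Import structures.
From mathcomp Require Import all_boot all_order all_algebra.
From mathcomp Require Import complex.
From mathcomp Require Import all_classical all_reals all_analysis.

Set Implicit Arguments.
Unset Strict Implicit.
Unset Printing Implicit Defensive.

Import Order.TTheory GRing.Theory Num.Theory.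
Import numFieldNormedType.Exports.

Local Open Scope classical_set_scope.
Local Open Scope complex_scope.
Local Open Scope ring_scope.

(* Complex Hilbert spaces.  The inner product is linear in its first argument
   and conjugate-linear in the second one. *)
HB.mixin Record CompleteNormedModule_isHilbert (R : realType) H
    & CompleteNormedModule R[i] H := {
  hdot : {dot H for (@Num.conj R[i] : R[i] -> R[i])};
  hdot_norm : forall x : H, `|x| ^+ 2 = hdot x x
}.

#[short(type="hilbertType")]
HB.structure Definition Hilbert (R : realType) :=
  {H of CompleteNormedModule_isHilbert R H & CompleteNormedModule R[i] H}.

(* Operators are plain functions [H -> H], with the pointwise [lmodType]
   structure; [idfun] is the identity operator. *)
Section operators.
Context {R : realType} {H : hilbertType R}.
Implicit Types S T : H -> H.

Definition bounded_linear T : Prop :=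
  linear T /\ exists M : R, forall x, `|T x| <= M%:C * `|x|.

Definition self_adjoint T : Prop :=
  bounded_linear T /\ forall x y, hdot (T x) y = hdot x (T y).

(* In [R[i]], [0 <= z] means that [z] is real and nonnegative. *)
Definition pos_semidef T : Prop :=
  self_adjoint T /\ forall x, 0 <= hdot (T x) x.

Definition loewner_le S T : Prop := pos_semidef (T - S).

Definition is_op_inverse T S : Prop :=
  [/\ bounded_linear S, S \o T = idfun & T \o S = idfun].

(* The inverse of an invertible operator; a junk value otherwise. *)
Definition op_inv T : H -> H := xget (idfun : H -> H) [set S | is_op_inverse T S].

Definition pos_cone : set (H -> H) :=
  [set T | pos_semidef T /\ exists S, is_op_inverse T S].

End operators.

Notation "S <=L T" := (loewner_le S T) (at level 70, no associativity).

Definition prob_vec {R : realType} (n : nat) : set ('I_n -> R) :=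
  [set w | (forall i, 0 < w i) /\ \sum_(i < n) w i = 1].
Arguments prob_vec {R} n.

(* [G n] is only constrained on [prob_vec n] and on tuples in the cone, which it
   maps into the cone; its values elsewhere are irrelevant.  For [n = 0] there
   is no probability vector, so every clause is vacuous. *)
Record ordered_mean {R : realType} {H : hilbertType R}
    (G : forall n : nat, ('I_n -> R) -> ('I_n -> H -> H) -> H -> H) : Prop := {
  mean_pos : forall n w A, prob_vec n w -> (forall i, pos_cone (A i)) ->
    pos_cone (G n w A);
  mean_homogeneous : forall n w A (a : R), prob_vec n w ->
    (forall i, pos_cone (A i)) -> 0 < a ->
    G n w (fun i => a%:C *: A i) = a%:C *: G n w A;
  mean_monotone : forall n w A B, prob_vec n w ->
    (forall i, pos_cone (A i)) -> (forall i, pos_cone (B i)) ->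
    (forall i, B i <=L A i) -> G n w B <=L G n w A;
  mean_concave : forall n w A B (s : R), prob_vec n w ->
    (forall i, pos_cone (A i)) -> (forall i, pos_cone (B i)) ->
    0 <= s <= 1 ->
    (1 - s)%:C *: G n w A + s%:C *: G n w B
      <=L G n w (fun i => (1 - s)%:C *: A i + s%:C *: B i);
  mean_harmonic_le : forall n w A, prob_vec n w ->
    (forall i, pos_cone (A i)) ->
    op_inv (\sum_(i < n) (w i)%:C *: op_inv (A i)) <=L G n w A;
  mean_le_arithmetic : forall n w A, prob_vec n w ->
    (forall i, pos_cone (A i)) ->
    G n w A <=L \sum_(i < n) (w i)%:C *: A i
}.

Section parameterized_mean.
Context {R : realType} {H : hilbertType R}.
Variable G : forall n : nat, ('I_n -> R) -> ('I_n -> H -> H) -> H -> H.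

Definition param_mean_nneg (mu : R) n (w : 'I_n -> R) (A : 'I_n -> H -> H) :
    H -> H :=
  G w (fun i => A i + mu%:C *: idfun) - mu%:C *: idfun.

Definition param_mean (mu : R) n (w : 'I_n -> R) (A : 'I_n -> H -> H) :
    H -> H :=
  if 0 <= mu then param_mean_nneg mu w A
  else op_inv (param_mean_nneg (- mu) w (fun i => op_inv (A i))).

End parameterized_mean.

(* Main.v *)
Require Import Defs.
From mathcomp Require Import all_boot all_order all_algebra.
From mathcomp Require Import complex.
From mathcomp Require Import all_classical all_reals all_analysis.
From mathcomp Require Import ring lra.

Set Implicit Arguments.
Unset Strict Implicit.
Unset Printing Implicit Defensive.

Import Order.TTheory GRing.Theory Num.Theory.
Import numFieldNormedType.Exports.

Local Open Scope classical_set_scope.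
Local Open Scope complex_scope.
Local Open Scope ring_scope.

(* Concavity of [G] along [A + mu I] gives (i).  For (ii), writing
   [F s = G (A^-1 + s I) - s I], concavity of [F] reduces the claim to operator
   inversion being antitone and convex; both follow at once from
   [<T^-1 x, x> = sup_y (2 Re <x, y> - <T y, y>)].  For the inverses to exist,
   [F s] must lie in the cone: a positive operator is invertible iff it is
   coercive, i.e. above some [c I] with [c > 0] (if coercive, the Richardson
   iteration [y + e (b - T y)] contracts for small [e]), and by monotonicity and
   the harmonic bound [G] preserves the lower bound [(c + s) I]. *)

(** * The real inner product and norm underlying [hdot] *)

Section real_inner_product.
Context {R : realType} {H : hilbertType R}.
Implicit Types (x y z : H) (a : R).

(** [hdot] and the norm take values in [R[i]]; passing to real parts brings every estimate into the
    ordered field [R]. *)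
Definition rdot x y : R := complex.Re (hdot x y).
Definition rnorm x : R := complex.Re `|x|.

Lemma rdotC x y : rdot x y = rdot y x.
Proof.
have re_conj (z : R[i]) : complex.Re (Num.conj z) = complex.Re z by case: z.
by rewrite /rdot hermC expr0 mul1r; exact: re_conj.
Qed.

Lemma rdotDl x y z : rdot (x + y) z = rdot x z + rdot y z.
Proof.
have reD (u v : R[i]) : complex.Re (u + v) = complex.Re u + complex.Re v.
  by case: u v => ? ? [].
by rewrite /rdot linearDl; exact: reD.
Qed.

Lemma rdotZl a x y : rdot (a%:C *: x) y = a * rdot x y.
Proof.
have reZ (u : R[i]) : complex.Re (a%:C * u) = a * complex.Re u.
  by case: u => u v; rewrite /= mul0r subr0.
by rewrite /rdot linearZl_LR; exact: reZ.
Qed.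

Lemma rdotNl x y : rdot (- x) y = - rdot x y.
Proof.
have reN (u : R[i]) : complex.Re (- u) = - complex.Re u by case: u.
by rewrite /rdot linearNl; exact: reN.
Qed.

Lemma rdotDr x y z : rdot x (y + z) = rdot x y + rdot x z.
Proof. by rewrite !(rdotC x) rdotDl. Qed.

Lemma rdotZr a x y : rdot x (a%:C *: y) = a * rdot x y.
Proof. by rewrite !(rdotC x) rdotZl. Qed.

Lemma rdotNr x y : rdot x (- y) = - rdot x y.
Proof. by rewrite !(rdotC x) rdotNl. Qed.

Definition rdotE := (rdotDl, rdotDr, rdotNl, rdotNr, rdotZl, rdotZr).

Lemma normrE x : `|x| = (rnorm x)%:C.
Proof.
have := normr_ge0 x; rewrite lecE => /andP[/eqP/= im0 _].
by apply/eqP; rewrite eq_complex im0 !eqxx.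
Qed.

Lemma rnorm_ge0 x : 0 <= rnorm x.
Proof. by rewrite -ler0c -normrE. Qed.

Lemma rdotxx x : rdot x x = rnorm x ^+ 2.
Proof. by rewrite /rdot -hdot_norm normrE -rmorphXn. Qed.

Lemma rdotxx_ge0 x : 0 <= rdot x x.
Proof. by rewrite rdotxx sqr_ge0. Qed.

Lemma rnorm0 : rnorm 0 = 0.
Proof. by rewrite /rnorm normr0. Qed.

Lemma rnorm0_eq0 x : rnorm x = 0 -> x = 0.
Proof. by move=> x0; apply/eqP; rewrite -normr_eq0 normrE x0. Qed.

Lemma rnormD x y : rnorm (x + y) <= rnorm x + rnorm y.
Proof. by rewrite -lecR rmorphD /= -!normrE ler_normD. Qed.

Lemma rnormN x : rnorm (- x) = rnorm x.
Proof. by rewrite /rnorm normrN. Qed.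

Lemma rnormZ a x : 0 <= a -> rnorm (a%:C *: x) = a * rnorm x.
Proof.
by move=> a0; apply: complexI; rewrite -normrE normrZ ger0_norm ?ler0c//
  normrE rmorphM.
Qed.

Lemma ler_rnorm x y a : 0 <= a ->
  (rnorm x <= a * rnorm y) = (rdot x x <= a ^+ 2 * rdot y y).
Proof.
move=> a0; rewrite !rdotxx -exprMn ler_pXn2r// nnegrE ?mulr_ge0 ?rnorm_ge0//.
Qed.

End real_inner_product.

(** * Bounded and self-adjoint operators, and the Loewner order *)

Section bounded_operators.
Context {R : realType} {H : hilbertType R}.
Implicit Types (S T U : H -> H) (x y : H) (a : R).

Lemma linear_addf T : linear T -> {morph T : x y / x + y}.
Proof. by move=> lT x y; have := lT 1 x y; rewrite !scale1r. Qed.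

Lemma linear_scalef T : linear T -> forall k, {morph T : x / k *: x}.
Proof.
move=> lT k x; have T0 : T 0 = 0.
  by apply: (@addrI _ (T 0)); rewrite -linear_addf// !addr0.
by have := lT k x 0; rewrite T0 !addr0.
Qed.

Lemma linear_oppf T : linear T -> {morph T : x / - x}.
Proof. by move=> lT x; rewrite -scaleN1r linear_scalef// scaleN1r. Qed.

(** The bound is raised to at least [1], so that later arguments can divide by it. *)
Lemma bounded_linear_rnorm T : bounded_linear T ->
  exists2 M, 0 < M & forall x, rnorm (T x) <= M * rnorm x.
Proof.
move=> [_ [M hM]]; exists (Num.max M 1); first by rewrite lt_max ltr01 orbT.
move=> x; apply: (@le_trans _ _ (M * rnorm x)); last first.
  by rewrite ler_wpM2r ?rnorm_ge0// le_max lexx.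
by rewrite -lecR rmorphM /= -!normrE.
Qed.

Lemma rnorm_bounded_linear T M : linear T ->
  (forall x, rnorm (T x) <= M * rnorm x) -> bounded_linear T.
Proof.
by move=> lT hM; split => //; exists M => x; rewrite !normrE -rmorphM lecR.
Qed.

Lemma bounded_linear_id : bounded_linear (idfun : H -> H).
Proof. by apply: (@rnorm_bounded_linear _ 1) => // x; rewrite mul1r. Qed.

Lemma bounded_linearD S T : bounded_linear S -> bounded_linear T ->
  bounded_linear (S + T).
Proof.
move=> bS bT; have [MS _ hS] := bounded_linear_rnorm bS.
have [MT _ hT] := bounded_linear_rnorm bT.
apply: (@rnorm_bounded_linear _ (MS + MT)) => [k x y|x].
  by rewrite !fctE bS.1 bT.1 scalerDr addrACA.
by rewrite mulrDl (le_trans (rnormD _ _))// lerD.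
Qed.

Lemma bounded_linearZ a T : bounded_linear T -> bounded_linear (a%:C *: T).
Proof.
move=> bT; have [M _ hM] := bounded_linear_rnorm bT.
apply: (@rnorm_bounded_linear _ (`|a| * M)) => [k x y|x].
  by rewrite !fctE bT.1 scalerDr !scalerA mulrC.
have -> : rnorm ((a%:C *: T) x) = `|a| * rnorm (T x).
  rewrite fctE; have [a0|a0] := ger0P a; first by rewrite rnormZ.
  by rewrite -rnormN -scaleNr -rmorphN rnormZ// oppr_ge0 ltW.
by rewrite -mulrA ler_wpM2l.
Qed.

Lemma self_adjoint_id : self_adjoint (idfun : H -> H).
Proof. by split => //; exact: bounded_linear_id. Qed.

Lemma self_adjointD S T : self_adjoint S -> self_adjoint T ->
  self_adjoint (S + T).
Proof.
move=> [bS sS] [bT sT]; split; first exact: bounded_linearD.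
move=> x y; rewrite !fctE linearDl linearDr.
by congr (_ + _); [exact: sS|exact: sT].
Qed.

Lemma self_adjointZ a T : self_adjoint T -> self_adjoint (a%:C *: T).
Proof.
move=> [bT sT]; split; first exact: bounded_linearZ.
move=> x y; rewrite !fctE linearZl_LR linearZr_LR.
congr (_ * _); last exact: sT.
(* The scalar comes out of the second argument conjugated; being real, it is its own conjugate. *)
by apply/eqP; rewrite eq_complex /= oppr0 !eqxx.
Qed.

Lemma self_adjointB S T : self_adjoint S -> self_adjoint T ->
  self_adjoint (S - T).
Proof.
move=> sS sT; have -> : - T = (- 1)%:C *: T by rewrite rmorphN scaleN1r.
by apply: self_adjointD => //; exact: self_adjointZ.
Qed.

Lemma self_adjoint_scalar a : self_adjoint (a%:C *: (idfun : H -> H)).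
Proof. exact/self_adjointZ/self_adjoint_id. Qed.

Lemma self_adjoint_rdot T x y : self_adjoint T -> rdot (T x) y = rdot x (T y).
Proof. by move=> [_ sT]; rewrite /rdot sT. Qed.

(** Self-adjointness makes [hdot (T x) x] equal to its conjugate, hence real, so only the sign of
    its real part has to be checked. *)
Lemma pos_semidefP T : self_adjoint T ->
  (forall x, 0 <= rdot (T x) x) -> pos_semidef T.
Proof.
move=> sT pT; split => // x; rewrite lecE pT andbT /=.
have : hdot (T x) x = Num.conj (hdot (T x) x : R[i]).
  rewrite [LHS]hermC expr0 mul1r; congr (Num.conj _); exact/esym/(sT.2 x x).
set z := (hdot _ _ : R[i]); case: z => u v [/eqP/=].
by rewrite -addr_eq0 -mulr2n mulrn_eq0.
Qed.

Lemma pos_semidef_rdot T x : pos_semidef T -> 0 <= rdot (T x) x.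
Proof. by move=> [_ /(_ x)]; rewrite lecE => /andP[]. Qed.

Lemma loewner_leP S T : self_adjoint S -> self_adjoint T ->
  (forall x, rdot (S x) x <= rdot (T x) x) -> S <=L T.
Proof.
move=> sS sT le; apply: pos_semidefP => [|x]; first exact: self_adjointB.
by rewrite !fctE !rdotE subr_ge0.
Qed.

Lemma loewner_le_rdot S T x : S <=L T -> rdot (S x) x <= rdot (T x) x.
Proof. by move=> /(@pos_semidef_rdot _ x); rewrite !fctE !rdotE subr_ge0. Qed.

Lemma loewner_le_trans S T U : S <=L T -> T <=L U -> S <=L U.
Proof.
move=> ST TU; rewrite /loewner_le; have -> : U - S = (U - T) + (T - S).
  by rewrite addrA subrK.
apply: pos_semidefP => [|x]; first exact: self_adjointD TU.1 ST.1.
rewrite [(_ + _) x]/(((U - T) x) + ((T - S) x)) rdotDl.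
by rewrite addr_ge0 ?pos_semidef_rdot.
Qed.

End bounded_operators.

(** * Coercivity and invertibility *)

Section coercive_operators.
Context {R : realType} {H : hilbertType R}.
Implicit Types (S T : H -> H) (x y b : H) (c M : R).

(** * Richardson iteration for [T x = b] *)

Section richardson.
Variables (T : H -> H) (e q M : R).
Hypotheses (lT : linear T) (e_gt0 : 0 < e) (q_ge0 : 0 <= q) (q_lt1 : q < 1).
Hypothesis M_gt0 : 0 < M.
Hypothesis T_bnd : forall x, rnorm (T x) <= M * rnorm x.
Hypothesis ctr : forall x, rnorm (x - e%:C *: T x) <= q * rnorm x.
Variable b : H.

Let y n := iter n (fun x => x + e%:C *: (b - T x)) (0 : H).

(** One iteration turns the residual [r] into [r - e T r], which [ctr] shrinks by the factor [q]. *)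
Let residual n : rnorm (b - T (y n)) <= q ^+ n * rnorm b.
Proof.
elim: n => [|n ih].
  rewrite expr0 mul1r; have -> : T (y 0%N) = 0; last by rewrite subr0.
  by have := linear_scalef lT 0 0; rewrite !scale0r.
have -> : b - T (y n.+1) = (b - T (y n)) - e%:C *: T (b - T (y n)).
  by rewrite /= (linear_addf lT) (linear_scalef lT) opprD addrA.
by rewrite (le_trans (ctr _))// exprS -mulrA ler_wpM2l.
Qed.

(** The sum of the geometric series with terms [e * q ^+ k * rnorm b], which bound the lengths of
    the successive increments. *)
Let C := e * rnorm b / (1 - q).

Let C_ge0 : 0 <= C.
Proof. by rewrite divr_ge0 ?subr_ge0 ?mulr_ge0 ?rnorm_ge0 ?ltW. Qed.

(** The right-hand side is the geometric sum of the bounds on steps [n] to [n + m - 1], in closed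
    form so that the induction on [m] closes exactly. *)
Let increment n m : rnorm (y (n + m)%N - y n) <= C * q ^+ n * (1 - q ^+ m).
Proof.
elim: m => [|m ih]; first by rewrite addn0 subrr rnorm0 expr0 subrr mulr0.
have -> : y (n + m.+1)%N - y n =
    e%:C *: (b - T (y (n + m)%N)) + (y (n + m)%N - y n).
  by rewrite addnS [y _.+1]iterS -/(y _) addrA; congr (_ - _); rewrite addrC.
rewrite (le_trans (rnormD _ _))// rnormZ ?(ltW e_gt0)//.
have -> : C * q ^+ n * (1 - q ^+ m.+1) =
    e * (q ^+ (n + m) * rnorm b) + C * q ^+ n * (1 - q ^+ m).
  by rewrite /C exprD exprS; field; rewrite subr_eq0 gt_eqF.
by rewrite lerD// ler_pM2l.
Qed.

Let small d : 0 < d -> exists N, C * q ^+ N < d.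
Proof.
move=> d0; have qd : `|q| < 1 by rewrite ger0_norm.
have /cvgrPdist_lt/(_ _ d0)[N _ /(_ N (leqnn N))] := cvg_geometric C qd.
rewrite /= sub0r normrN ger0_norm; last by rewrite mulr_ge0// exprn_ge0.
by exists N.
Qed.

Lemma richardson_surjective : exists x, T x = b.
Proof.
have dist N n : (N <= n)%N -> rnorm (y n - y N) <= C * q ^+ N.
  move=> /subnKC <-; rewrite (le_trans (increment _ _))// ler_piMr//.
    by rewrite mulr_ge0// exprn_ge0.
  by rewrite gerBl exprn_ge0.
(* Radii of balls in [H] lie in [R[i]]; a positive one is real. *)
have real_pos (d : R[i]) : 0 < d -> exists2 r : R, 0 < r & d = r%:C.
  rewrite ltcE /= => /andP[/eqP im0 re0]; exists (complex.Re d) => //.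
  by apply/eqP; rewrite eq_complex im0 !eqxx.
have /cauchy_cvgP/cvg_ex[p yp] : cauchy (y n @[n --> \oo]).
  apply: cauchy_exP => _ /real_pos[d d0 ->].
  have [N CN] := small d0; exists (y N), N => // n /= Nn.
  by rewrite -ball_normE /= distrC normrE ltcR (le_lt_trans (dist _ _ Nn)).
exists p; apply/eqP; rewrite -subr_eq0; apply/eqP/rnorm0_eq0.
apply/eqP; rewrite eq_le rnorm_ge0 andbT.
apply/ler_addgt0Pr => d d0; rewrite add0r.
(* The error [T p - b] splits into [T (p - y n)] and the residual at [n], each allowed [d / 2]. The
   first needs [p - y n] below [d / (2 * M)]. For the second, [rnorm b = C * (1 - q) / e], so
   [C * q ^+ N] must be below [e * d / (2 * (1 - q))]. *)
have d1 : 0 < d / (2 * M) by rewrite divr_gt0// mulr_gt0.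
have d2 : 0 < e * d / (2 * (1 - q)).
  by rewrite divr_gt0 ?mulr_gt0 ?subr_gt0.
have [N CN] := small d2.
have [K _ hK] : \forall n \near \oo, `|p - y n| < (d / (2 * M))%:C.
  by move/cvgrPdist_lt : yp; apply; rewrite ltcR.
pose n := maxn N K.
have -> : T p - b = T (p - y n) - (b - T (y n)).
  by rewrite (linear_addf lT) (linear_oppf lT) opprB addrA subrK.
rewrite (le_trans (rnormD _ _))// rnormN (splitr d) lerD//.
  rewrite (le_trans (T_bnd _))// -ler_pdivlMl//.
  have := hK n (leq_maxr _ _); rewrite /= normrE ltcR => /ltW/le_trans; apply.
  by rewrite invfM mulrA mulrC.
rewrite (le_trans (residual _))//.
have qN : q ^+ n <= q ^+ N by rewrite ler_wiXn2l ?leq_maxl// ltW.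
rewrite (le_trans (ler_wpM2r (rnorm_ge0 _) qN))//.
have -> : q ^+ N * rnorm b = C * q ^+ N * ((1 - q) / e).
  by rewrite /C; field; rewrite subr_eq0 !gt_eqF.
have -> : d / 2 = e * d / (2 * (1 - q)) * ((1 - q) / e).
  by field; rewrite subr_eq0 !gt_eqF.
by rewrite ler_wpM2r ?divr_ge0 ?subr_ge0 ?ltW.
Qed.

End richardson.

(** A form of Cauchy-Schwarz, read off from the square of [x - M y] being nonnegative. *)
Lemma rdot_le_rnorm x y M : 0 < M -> rnorm x <= M * rnorm y ->
  rdot x y <= M * rdot y y.
Proof.
move=> M0; rewrite ler_rnorm ?(ltW M0)// => le_xy.
have := rdotxx_ge0 (x - M%:C *: y).
rewrite !rdotE (rdotC y x) => ge0.
by rewrite -(ler_pM2l M0); lra.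
Qed.

(** Expanding the square of [T x - c x] bounds [T] from below, which yields both injectivity and the
    bound on the inverse. *)
Lemma coercive_rnorm T c : 0 < c ->
  (forall x, c * rdot x x <= rdot (T x) x) ->
  forall x, rnorm x <= c^-1 * rnorm (T x).
Proof.
move=> c0 cT x; rewrite ler_rnorm ?invr_ge0 ?(ltW c0)//.
rewrite exprVn ler_pdivlMl ?exprn_gt0//.
have := rdotxx_ge0 (T x - c%:C *: x).
rewrite !rdotE (rdotC x (T x)).
have := ler_wpM2l (ltW c0) (cT x); lra.
Qed.

Lemma coercive_surjective T c : bounded_linear T -> 0 < c ->
  (forall x, c * rdot x x <= rdot (T x) x) -> forall b, exists x, T x = b.
Proof.
move=> bT c0 cT b; have [M0 M0_gt0 hM0] := bounded_linear_rnorm bT.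
(* Adding [c] forces [c <= M], hence [0 <= k] below. *)
pose M := M0 + c; have M_gt0 : 0 < M by rewrite addr_gt0.
have hM x : rnorm (T x) <= M * rnorm x.
  by rewrite (le_trans (hM0 x))// ler_wpM2r ?rnorm_ge0// lerDl ltW.
pose k := 1 - c ^+ 2 / M ^+ 2.
have k_ge0 : 0 <= k.
  rewrite subr_ge0 ler_pdivrMr ?exprn_gt0// mul1r.
  by rewrite ler_pXn2r ?nnegrE ?(ltW c0) ?(ltW M_gt0)// lerDr ltW.
(* The squared norm of [x - e T x] is at most [1 - 2 e c + e^2 M^2] times that of [x]; [e = c / M^2]
   minimises this factor, with value [k]. *)
apply: (@richardson_surjective T (c / M ^+ 2) (Num.sqrt k) M) => //.
- exact: bT.1.
- by rewrite divr_gt0// exprn_gt0.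
- by rewrite -[ltRHS]sqrtr1 ltr_sqrt// gtrBl divr_gt0 ?exprn_gt0.
move=> x; rewrite ler_rnorm ?sqrtr_ge0// sqr_sqrtr// !rdotE (rdotC x (T x)).
have := hM x; rewrite ler_rnorm ?(ltW M_gt0)// => le1; have le2 := cT x.
set e := c / M ^+ 2; have e_gt0 : 0 < e by rewrite divr_gt0 ?exprn_gt0.
have {}le1 := ler_wpM2l (ltW (mulr_gt0 e_gt0 e_gt0)) le1.
have {}le2 := ler_wpM2l (ltW e_gt0) le2.
have -> : k = 1 - e * c by rewrite /k /e; field; rewrite gt_eqF.
have eM : e * e * (M ^+ 2 * rdot x x) = e * (c * rdot x x).
  by rewrite /e; field; rewrite gt_eqF.
by rewrite eM in le1; lra.
Qed.

(** Surjectivity gives a right inverse by choice; injectivity of [T] makes it two-sided and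
    linear. *)
Lemma coercive_invertible T c : bounded_linear T -> 0 < c ->
  (forall x, c * rdot x x <= rdot (T x) x) -> exists S, is_op_inverse T S.
Proof.
move=> bT c0 cT; have lT := bT.1.
have [S TS] := choice (coercive_surjective bT c0 cT).
have injT : injective T.
  move=> x y Txy; apply/eqP; rewrite -subr_eq0; apply/eqP/rnorm0_eq0/eqP.
  rewrite eq_le rnorm_ge0 andbT (le_trans (coercive_rnorm c0 cT _))//.
  by rewrite (linear_addf lT) (linear_oppf lT) Txy subrr rnorm0 mulr0.
exists S; split; last 2 first.
- by apply/funext => x; apply: injT; rewrite /= TS.
- by apply/funext => x; rewrite /= TS.
apply: (@rnorm_bounded_linear _ _ _ c^-1) => [k x y|x].
  by apply: injT; rewrite (linear_addf lT) (linear_scalef lT) !TS.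
by rewrite (le_trans (coercive_rnorm c0 cT _))// TS.
Qed.

Lemma rdot_scalar c x :
  rdot ((c%:C *: (idfun : H -> H)) x) x = c * rdot x x.
Proof. exact: rdotZl. Qed.

Lemma pos_cone_of_scalar_le T c : 0 < c -> self_adjoint T ->
  c%:C *: (idfun : H -> H) <=L T -> pos_cone T.
Proof.
move=> c0 sT cT.
have coT x : c * rdot x x <= rdot (T x) x.
  by rewrite -rdot_scalar; exact: (loewner_le_rdot x cT).
split; last exact: coercive_invertible sT.1 c0 coT.
apply: pos_semidefP => // x.
by rewrite (le_trans _ (coT x))// mulr_ge0 ?rdotxx_ge0 ?(ltW c0).
Qed.

Lemma pos_cone_self_adjoint T : pos_cone T -> self_adjoint T.
Proof. by case=> -[]. Qed.

(** With [M] bounding [T] and [N] its inverse, [<T x, x> >= |T x|^2 / M >= |x|^2 / (M N^2)]. *)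
Lemma pos_cone_scalar_le T : pos_cone T ->
  exists2 c : R, 0 < c & c%:C *: (idfun : H -> H) <=L T.
Proof.
move=> [pT [S [bS ST _]]]; have [sT _] := pT; have lT := sT.1.1.
have [M M0 hM] := bounded_linear_rnorm sT.1.
have [N N0 hN] := bounded_linear_rnorm bS.
exists (M * N ^+ 2)^-1; first by rewrite invr_gt0 mulr_gt0 ?exprn_gt0.
apply: loewner_leP => //; first exact: self_adjoint_scalar.
move=> x; rewrite rdot_scalar.
rewrite ler_pdivrMl ?mulr_gt0 ?exprn_gt0//.
have le1 : rdot x x <= N ^+ 2 * rdot (T x) (T x).
  by rewrite -ler_rnorm ?(ltW N0)// -{1}[x]/(idfun x) -ST hN.
have le2 := rdot_le_rnorm M0 (hM (T x)).
(* Positivity at [x - M^-1 T x], together with [<T (T x), T x> <= M |T x|^2], gives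
   [|T x|^2 / M <= <T x, x>] without a square root of [T]. *)
have := pos_semidef_rdot (x - M^-1%:C *: T x) pT.
rewrite (linear_addf lT) (linear_oppf lT) (linear_scalef lT) !rdotE.
rewrite (self_adjoint_rdot (T x) x sT).
move: le1 le2; set u := rdot (T x) (T x); set v := rdot (T (T x)) _.
move=> le1 le2 le3; rewrite (le_trans le1)// (mulrC M) -(mulrA (N ^+ 2) M).
rewrite ler_wpM2l ?exprn_ge0 ?(ltW N0)// -ler_pdivrMl//.
have Mi_ge0 : 0 <= M^-1 by rewrite invr_ge0 ltW.
have := ler_wpM2l Mi_ge0 (ler_wpM2l Mi_ge0 le2).
rewrite [M^-1 * (M * u)]mulKf ?gt_eqF//; lra.
Qed.

End coercive_operators.

(** * Inverses of operators in the cone *)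

Section operator_inverse.
Context {R : realType} {H : hilbertType R}.
Implicit Types (S T X Y Z : H -> H) (x y : H) (a c t : R).

(** A two-sided inverse is unique, so the choice made by [xget] agrees with any given inverse. *)
Lemma op_inv_eq T S : is_op_inverse T S -> op_inv T = S.
Proof.
move=> invS; have [_ ST TS] := invS.
have [_ invT _] : is_op_inverse T (op_inv T) by apply: xgetPex; exists S.
apply/funext => x.
by rewrite -{1}[x]/(idfun x) -TS -[LHS]/((_ \o T) (S x)) invT.
Qed.

Lemma pos_cone_op_invP T : pos_cone T -> is_op_inverse T (op_inv T).
Proof. by move=> [_ [S invS]]; rewrite (op_inv_eq invS). Qed.

Lemma op_invK T x : pos_cone T -> T (op_inv T x) = x.
Proof.
by move=> /pos_cone_op_invP[_ _ TS]; rewrite -[LHS]/((T \o op_inv T) x) TS.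
Qed.

(** Symmetry and positivity transfer from [T] by writing each vector [x] as [T (op_inv T x)]. *)
Lemma pos_cone_op_inv T : pos_cone T -> pos_cone (op_inv T).
Proof.
move=> posT; have [bS ST TS] := pos_cone_op_invP posT.
have [[bT sT] pT] := posT.1.
have sS : self_adjoint (op_inv T).
  split=> // x y; have := sT (op_inv T x) (op_inv T y).
  by rewrite !op_invK// => /esym.
split; last by exists T; split.
apply: pos_semidefP => // x.
rewrite rdotC -{1}(op_invK x posT); exact: pos_semidef_rdot posT.1.
Qed.

Lemma op_inv_scalar c : 0 < c ->
  op_inv (c%:C *: (idfun : H -> H)) = c^-1%:C *: idfun.
Proof.
move=> c0; have cV : c * c^-1 = 1 by rewrite mulfV ?gt_eqF.
apply: op_inv_eq; split; first exact: (self_adjoint_scalar _).1.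
- by apply/funext => x; rewrite /= !fctE scalerA -rmorphM mulrC cV scale1r.
- by apply/funext => x; rewrite /= !fctE scalerA -rmorphM cV scale1r.
Qed.

Lemma pos_cone_scalar c : 0 < c -> pos_cone (c%:C *: (idfun : H -> H)).
Proof.
move=> c0; have sc := @self_adjoint_scalar _ H c.
by apply: (pos_cone_of_scalar_le c0) => //; exact: loewner_leP.
Qed.

Lemma pos_cone_add_scalar T a : pos_cone T -> 0 <= a ->
  pos_cone (T + a%:C *: idfun).
Proof.
move=> posT a0; have [c c0 cT] := pos_cone_scalar_le posT.
have sT := pos_cone_self_adjoint posT.
have sTa : self_adjoint (T + a%:C *: idfun).
  by apply: self_adjointD => //; exact: self_adjoint_scalar.
apply: (pos_cone_of_scalar_le c0) => //; apply: (loewner_le_trans cT).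
apply: loewner_leP => // x.
by rewrite rdotDl rdot_scalar lerDl mulr_ge0 ?rdotxx_ge0.
Qed.

(* The supremum of the left-hand side over [y] is attained at [y = T^-1 x];
   this writes [T^-1] as a supremum of functions affine in [T]. *)
Lemma op_inv_variational T x y : pos_cone T ->
  2 * rdot x y - rdot (T y) y <= rdot (op_inv T x) x.
Proof.
move=> posT; have lT := (pos_cone_self_adjoint posT).1.1.
have := pos_semidef_rdot (op_inv T x - y) posT.1.
rewrite (linear_addf lT) (linear_oppf lT) op_invK// !rdotE.
rewrite (self_adjoint_rdot _ _ (pos_cone_self_adjoint posT)) op_invK//.
rewrite (rdotC y x) (rdotC x (op_inv T x)); lra.
Qed.

(** Antitonicity and convexity in one statement: [t = 0] gives the first, and taking [Z] to be the
    convex combination gives the second. *)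
Lemma op_inv_antitone_convex X Y Z t : pos_cone X -> pos_cone Y ->
  pos_cone Z -> 0 <= t <= 1 -> (1 - t)%:C *: X + t%:C *: Y <=L Z ->
  op_inv Z <=L (1 - t)%:C *: op_inv X + t%:C *: op_inv Y.
Proof.
move=> posX posY posZ /andP[t0 t1] leZ.
apply: loewner_leP => [||x].
- exact/pos_cone_self_adjoint/pos_cone_op_inv.
- by apply: self_adjointD; apply: self_adjointZ;
    exact/pos_cone_self_adjoint/pos_cone_op_inv.
(* This [y] attains the supremum for [Z]; inserting the same [y] in the variational bounds for [X]
   and [Y] and averaging them suffices. *)
set y := op_inv Z x; have Zy : Z y = x by exact: op_invK.
have := loewner_le_rdot y leZ; rewrite Zy !fctE !rdotE (rdotC y x) => leZy.
have t1' : 0 <= 1 - t by rewrite subr_ge0.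
have := ler_wpM2l t1' (op_inv_variational x y posX).
have := ler_wpM2l t0 (op_inv_variational x y posY).
lra.
Qed.

End operator_inverse.

(** * Positivity and concavity of the parameterized mean for nonnegative parameters *)

Section ordered_mean_theory.
Context {R : realType} {H : hilbertType R}.
Variable G : forall n : nat, ('I_n -> R) -> ('I_n -> H -> H) -> H -> H.
Hypothesis hG : ordered_mean G.
Variables (n : nat) (w : 'I_n -> R).
Hypothesis hw : prob_vec n w.
Implicit Types (A : 'I_n -> H -> H) (c s t : R).

(** By monotonicity it suffices to treat the constant tuple [c I], whose harmonic mean is [c I]
    because the weights sum to [1]. *)
Lemma scalar_le_mean A c : 0 < c -> (forall i, pos_cone (A i)) ->
  (forall i, c%:C *: (idfun : H -> H) <=L A i) -> c%:C *: idfun <=L G w A.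
Proof.
move=> c0 posA cA; have posc := @pos_cone_scalar _ H _ c0.
apply: (@loewner_le_trans _ _ _ (G w (fun=> c%:C *: idfun))); last first.
  exact: (mean_monotone hG hw).
have := mean_harmonic_le hG hw (fun _ : 'I_n => posc).
rewrite op_inv_scalar// -scaler_suml -rmorph_sum hw.2 scale1r.
by rewrite op_inv_scalar ?invr_gt0// invrK.
Qed.

Lemma param_mean_nneg_pos A s : 0 <= s -> (forall i, pos_cone (A i)) ->
  pos_cone (param_mean_nneg G s w A).
Proof.
move=> s0 posA.
have [c c_gt0 cA] : exists2 c, 0 < c &
    forall i, c%:C *: (idfun : H -> H) <=L A i.
  have /choice[f fA] : forall i, exists c, 0 < c /\
      c%:C *: (idfun : H -> H) <=L A i.
    by move=> i; have [c c0 cAi] := pos_cone_scalar_le (posA i); exists c.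
  (* The default [1] takes part in the minimum; being positive, it keeps the common constant
     positive. *)
  exists (\big[Num.min/1]_i f i).
    by apply: lt_bigmin => // i _; have [] := fA i.
  move=> i; apply: loewner_le_trans (fA i).2.
  apply: loewner_leP => [||x]; try exact: self_adjoint_scalar.
  by rewrite !rdot_scalar ler_wpM2r ?rdotxx_ge0// bigmin_le_cond.
have posAs i : pos_cone (A i + s%:C *: idfun) by exact: pos_cone_add_scalar.
have posG : pos_cone (G w (fun i => A i + s%:C *: idfun)).
  exact: (mean_pos hG hw).
have sF : self_adjoint (param_mean_nneg G s w A).
  apply: self_adjointB (self_adjoint_scalar _).
  exact: pos_cone_self_adjoint.
apply: (pos_cone_of_scalar_le c_gt0) => //.
(* Moving [s I] across, the claim becomes [(c + s) I <= G (A + s I)]. *)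
rewrite /loewner_le /param_mean_nneg -addrA -opprD -scalerDl -rmorphD.
apply: scalar_le_mean => //; first by rewrite ltr_wpDl.
move=> i; rewrite /loewner_le rmorphD scalerDl opprD.
by rewrite [- _ - _]addrC addrACA subrr addr0; exact: cA.
Qed.

(** The shift [A + s I] is affine in [s], so concavity of [G] applies; the subtracted [s I] is
    affine too and cancels. *)
Lemma param_mean_nneg_concave A t mu nu : (forall i, pos_cone (A i)) ->
  0 <= t <= 1 -> 0 <= mu -> 0 <= nu ->
  (1 - t)%:C *: param_mean_nneg G mu w A + t%:C *: param_mean_nneg G nu w A
    <=L param_mean_nneg G ((1 - t) * mu + t * nu) w A.
Proof.
move=> posA t01 mu0 nu0.
have pos s : 0 <= s -> forall i, pos_cone (A i + s%:C *: idfun).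
  by move=> s0 i; exact: pos_cone_add_scalar.
have := mean_concave hG hw (pos _ mu0) (pos _ nu0) t01.
have -> : (fun i => (1 - t)%:C *: (A i + mu%:C *: idfun) +
                   t%:C *: (A i + nu%:C *: idfun)) =
          (fun i => A i + ((1 - t) * mu + t * nu)%:C *: idfun).
  apply/funext => i; rewrite !scalerDr !scalerA addrACA -!scalerDl.
  by rewrite -!rmorphM -!rmorphD subrK scale1r.
rewrite /loewner_le /param_mean_nneg => concG.
rewrite !scalerBr addrACA -opprD !scalerA -scalerDl -!rmorphM -rmorphD.
by rewrite opprB addrA subrK.
Qed.

End ordered_mean_theory.

Theorem theorem4p2 (R : realType) (H : hilbertType R)
    (G : forall n : nat, ('I_n -> R) -> ('I_n -> H -> H) -> H -> H)
    (hG : ordered_mean G) (n : nat) (A : 'I_n -> H -> H)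
    (hA : forall i, pos_cone (A i)) (w : 'I_n -> R) (hw : prob_vec n w)
    (t : R) (ht : 0 <= t <= 1) :
  (forall mu nu : R, 0 <= mu -> 0 <= nu ->
    (1 - t)%:C *: param_mean G mu w A + t%:C *: param_mean G nu w A
      <=L param_mean G ((1 - t) * mu + t * nu) w A) /\
  (forall mu nu : R, mu < 0 -> nu < 0 ->
    param_mean G ((1 - t) * mu + t * nu) w A
      <=L (1 - t)%:C *: param_mean G mu w A + t%:C *: param_mean G nu w A).
Proof.
split=> mu nu mu0 nu0; case/andP: (ht) => t0 t1.
  have conv0 : 0 <= (1 - t) * mu + t * nu.
    by rewrite addr_ge0 ?mulr_ge0 ?subr_ge0.
  rewrite /param_mean mu0 nu0 conv0; exact: param_mean_nneg_concave.
have conv0 : (1 - t) * mu + t * nu < 0.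
  (* Strictness comes from the [mu] term when [t < 1]; at [t = 1] that term vanishes and only [nu]
     remains. *)
  have [->|t_neq1] := eqVneq t 1; first by rewrite subrr mul0r add0r mul1r.
  have t_lt1 : 0 < 1 - t by rewrite subr_gt0 lt_neqAle t_neq1.
  have : (1 - t) * mu < 0 by rewrite pmulr_rlt0.
  by have := mulr_ge0_le0 t0 (ltW nu0); lra.
rewrite /param_mean !leNgt mu0 nu0 conv0 /=.
have posV i : pos_cone (op_inv (A i)) by exact: pos_cone_op_inv.
have posF s : s < 0 ->
    pos_cone (param_mean_nneg G (- s) w (fun i => op_inv (A i))).
  by move=> s0; apply: (param_mean_nneg_pos hG hw) => //; rewrite oppr_ge0 ltW.
(* Here [X], [Y], [Z] are the nonnegative-parameter means of the inverses at the negated parameters,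
   so the remaining hypothesis is their concavity. *)
apply: op_inv_antitone_convex => //; try exact: posF.
rewrite opprD -!mulrN; apply: (param_mean_nneg_concave hG hw) => //;
  by rewrite oppr_ge0 ltW.
Qed.
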